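(* Let $r\ge 1$ be an integer, let $\mathcal O\subseteq\mathbb R^{n+m}$ be open, and let $f:\mathcal O\to\mathbb R^n$ be of class $C^r$. Let $N$ be a positive integer. Then the terminal-state-augmented $N$-step behavior $\mathfrak B_N^{+}$ of the system $x_{k+1}=f(x_k,u_k)$ is a $C^r$ embedded submanifold of $\mathbb R^{Nm+(N+1)n}$, and its dimension is $$\dim \mathfrak B_N^{+}=n+Nm.$$ Moreover, the rollout parameterization $\Phi_N$ is a $C^r$ diffeomorphism from $\mathcal D_N$ onto $\mathfrak B_N^{+}$ equipped with its embedded-submanifold structure.
   Context: Here $n,m,N$ are positive integers and $\operatorname{col}(\cdot)$ denotes vertical stacking of vectors. A pair $(x,u)\in\mathbb R^n\times\mathbb R^m$ is identified with a point of $\mathbb R^{n+m}$. The terminal-state-augmented $N$-step behavior is $$\mathfrak B_N^{+}:=\{\operatorname{col}(u_0,\ldots,u_{N-1},x_0,\ldots,x_N)\in\mathbb R^{Nm+(N+1)n} : (x_k,u_k)\in\mathcal O,\ x_{k+1}=f(x_k,u_k),\ k=0,\ldots,N-1\},$$ with $u_k\in\mathbb R^m$, $x_k\in\mathbb R^n$. Free coordinates: $q=\operatorname{col}(x_0,u_0,\ldots,u_{N-1})\in\mathbb R^{n+Nm}$. Rollout: $x_0(q)=x_0$ and, recursively, whenever the previous states are well-defined and $(x_k(q),u_k)\in\mathcal O$, $x_{k+1}(q)=f(x_k(q),u_k)$. The admissible rollout domain $\mathcal D_N\subseteq\mathbb R^{n+Nm}$ is the set of all $q$ such that $(x_k(q),u_k)\in\mathcal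 O$ for $k=0,\ldots,N-1$; it is regarded as a subset of $\mathbb R^{n+Nm}$ with the usual structure. The rollout parameterization is $$\Phi_N:\mathcal D_N\to\mathbb R^{Nm+(N+1)n},\qquad \Phi_N(q)=\operatorname{col}(u_0,\ldots,u_{N-1},x_0(q),x_1(q),\ldots,x_N(q)).$$ Convention: the empty set is regarded as an embedded submanifold of any dimension. *)

(* Defs.v *)
From HB Require Import structures.
From mathcomp Require Import all_boot all_order all_algebra.
From mathcomp Require Import all_classical all_reals all_analysis.
Set Implicit Arguments.
Unset Strict Implicit.
Unset Printing Implicit Defensive.
Import Order.TTheory GRing.Theory Num.Theory.
Import numFieldNormedType.Exports.
Local Open Scope classical_set_scope.
Local Open Scope ring_scope.

(* Points of R^p are row vectors, so col(v, w) is [row_mx v w], and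
   col(v_0, ..., v_(k-1)) is [mxvec] of the matrix whose i-th row is v_i. *)

Section Smoothness.
Variable R : realType.

(* To be used with U open, where it only depends on the restriction of F to U:
   F is differentiable on U with a derivative of class C^(r-1), the derivative
   being recorded by its values x |-> DF(x) v at all vectors v. *)
Fixpoint Cr (r p q : nat) (U : set 'rV[R]_p) (F : 'rV[R]_p -> 'rV[R]_q) : Prop :=
  match r with
  | 0%N => forall x, U x -> {for x, continuous F}
  | r'.+1 => (forall x, U x -> differentiable F x) /\
             (forall v : 'rV[R]_p, Cr r' U (fun x => 'D_v F x))
  end.

Definition inverse_on (p q : nat) (A : set 'rV[R]_p) (B : set 'rV[R]_q)
    (F : 'rV[R]_p -> 'rV[R]_q) (G : 'rV[R]_q -> 'rV[R]_p) : Prop :=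
  (forall x, A x -> B (F x) /\ G (F x) = x) /\
  (forall y, B y -> A (G y) /\ F (G y) = y).

Definition open_diffeo (r p : nat) (U V : set 'rV[R]_p)
    (phi psi : 'rV[R]_p -> 'rV[R]_p) : Prop :=
  [/\ open U, open V, inverse_on U V phi psi, Cr r U phi & Cr r V psi].

(* R^d embedded as R^d x {0} in R^M, and the projection of R^M onto its first
   d coordinates; only meaningful for d <= M. *)
Definition incl (d M : nat) (y : 'rV[R]_d) : 'rV[R]_M := y *m pid_mx d.
Definition proj (d M : nat) (z : 'rV[R]_M) : 'rV[R]_d := z *m pid_mx d.

(* The induced chart of S is the map [proj d \o phi] on S `&` U, with inverse
   [psi \o incl M] on [set y | V (incl M y)]. *)
Definition slice_chart (r d M : nat) (S U V : set 'rV[R]_M)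
    (phi psi : 'rV[R]_M -> 'rV[R]_M) : Prop :=
  [/\ (d <= M)%N, open_diffeo r U V phi psi &
      phi @` (S `&` U) = V `&` [set z | forall i : 'I_M, (d <= i)%N -> z 0 i = 0]].

Definition embedded_submanifold (r d M : nat) (S : set 'rV[R]_M) : Prop :=
  forall s, S s -> exists (U V : set 'rV[R]_M) (phi psi : 'rV[R]_M -> 'rV[R]_M),
    U s /\ slice_chart r d S U V phi psi.

Definition Cr_into_submanifold (r d p M : nat) (D : set 'rV[R]_p)
    (S : set 'rV[R]_M) (F : 'rV[R]_p -> 'rV[R]_M) : Prop :=
  [/\ (forall q, D q -> S (F q)), (forall q, D q -> {for q, continuous F}) &
      forall U V phi psi, slice_chart r d S U V phi psi ->
        Cr r (D `&` F @^-1` U) (fun q => proj d (phi (F q)))].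

Definition Cr_on_submanifold (r d p M : nat) (S : set 'rV[R]_M)
    (G : 'rV[R]_M -> 'rV[R]_p) : Prop :=
  forall U V phi psi, slice_chart r d S U V phi psi ->
    Cr r [set y : 'rV[R]_d | V (incl M y)] (fun y => G (psi (incl M y))).

(* C^r diffeomorphism from an open subset D of R^p onto the d-dimensional
   embedded submanifold S with the manifold structure given by its slice
   charts. *)
Definition Cr_diffeo_onto (r d p M : nat) (D : set 'rV[R]_p) (S : set 'rV[R]_M)
    (F : 'rV[R]_p -> 'rV[R]_M) : Prop :=
  [/\ open D, embedded_submanifold r d S, Cr_into_submanifold r d D S F &
      exists G : 'rV[R]_M -> 'rV[R]_p,
        inverse_on D S F G /\ Cr_on_submanifold r d S G].

End Smoothness.

Section Behavior.
Variables (R : realType) (n m : nat).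
(* Only the values of f on O matter below. *)
Variables (O : set 'rV[R]_(n + m)) (f : 'rV[R]_(n + m) -> 'rV[R]_n) (N : nat).

(* col(u_0, ..., u_(N-1), x_0, ..., x_N); later terms are ignored. *)
Definition trajectory (u : nat -> 'rV[R]_m) (x : nat -> 'rV[R]_n) :
    'rV[R]_(N * m + N.+1 * n) :=
  row_mx (mxvec (\matrix_(k < N) u k)) (mxvec (\matrix_(k < N.+1) x k)).

Definition behavior : set 'rV[R]_(N * m + N.+1 * n) :=
  [set w | exists (u : nat -> 'rV[R]_m) (x : nat -> 'rV[R]_n),
    w = trajectory u x /\
    forall k, (k < N)%N ->
      O (row_mx (x k) (u k)) /\ x k.+1 = f (row_mx (x k) (u k))].

(* Free coordinates q = col(x_0, u_0, ..., u_(N-1)). *)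
Definition input (q : 'rV[R]_(n + N * m)) (k : nat) : 'rV[R]_m :=
  if insub k is Some i then row (i : 'I_N) (vec_mx (rsubmx q)) else 0.

Fixpoint state (q : 'rV[R]_(n + N * m)) (k : nat) : 'rV[R]_n :=
  if k is k'.+1 then f (row_mx (state q k') (input q k')) else lsubmx q.

Definition rollout_domain : set 'rV[R]_(n + N * m) :=
  [set q | forall k, (k < N)%N -> O (row_mx (state q k) (input q k))].

Definition rollout (q : 'rV[R]_(n + N * m)) : 'rV[R]_(N * m + N.+1 * n) :=
  trajectory (input q) (state q).

End Behavior.

Arguments behavior {R n m} O f N.
Arguments rollout_domain {R n m} O f N.
Arguments rollout {R n m} f N q.

(* Main.v *)
From HB Require Import structures.
Require Import Defs.
From mathcomp Require Import all_boot all_order all_algebra.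
From mathcomp Require Import all_classical all_reals all_analysis.
Import numFieldNormedType.Exports.
Import Order.TTheory GRing.Theory Num.Theory.
Local Open Scope classical_set_scope.
Local Open Scope ring_scope.

(** The rollout map is a right inverse of a linear map.  The point
    w = col(u_0, ..., u_(N-1), x_0, ..., x_N) of a behavior is determined by its
    free coordinates P w = col(x_0, u_0, ..., u_(N-1)), and P, which merely
    selects coordinates, is linear on the whole of R^(Nm+(N+1)n); the behavior
    is the image of the rollout domain D under the rollout F, and P (F q) = q
    on D ([behaviorE], [free_coord_rollout]).

    The domain D is open and F is C^r on it, by induction on the time: the k-th
    state is a C^r function on the open set where the first k steps are
    admissible, the next step is admissible on the preimage of the open set O
    under the C^r map q |-> (x_k(q), u_k), and the next state is the composite
    of this map with f ([state_Cr]).  This rests on the C^r calculus: sums,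
    linear maps, composites ([Cr_comp]).

    Geometry is then left to a general fact ([linear_section_diffeo]): if D is
    open in R^d, F : D -> R^M is C^r and P : R^M -> R^d is a surjective linear
    map with P (F q) = q on D, then F(D) is a C^r embedded submanifold of
    dimension d and F is a C^r diffeomorphism onto it, with inverse the
    restriction of P.  Indeed F(D) is, in suitable linear coordinates, a graph
    over D, and subtracting F (P w) from w straightens it: for a linear
    automorphism T of R^M mapping ker P onto 0 x R^(M-d),
    w |-> T (w - F (P w)) + (P w, 0) is a C^r diffeomorphism between open sets
    which maps F(D) onto the slice D x 0 ([linear_section_chart]).  It is a
    single chart for all of F(D), and its inverse is given by an equally
    explicit formula, so no inverse function theorem is involved. *)

(** * The C^r calculus *)

Lemma near_eq_differentiable (R : numFieldType) (V W : normedModType R)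
    (f g : V -> W) (x : V) :
  (\near x, f x = g x) -> differentiable f x -> differentiable g x.
Proof.
move=> fg /diff_locallyP[df_cont fE].
have gE : g \o shift x = cst (g x) + 'd f x +o_ 0 id.
  rewrite -(nbhs_singleton fg); apply/eqaddoP => e e0.
  move/eqaddoP: fE => /(_ e e0) fE.
  move: fg; rewrite (near_shift 0 x) => fg.
  apply: filterS2 fg fE.
  by move=> h; rewrite /= !fctE /= subr0 => ->.
have dE := diff_unique df_cont gE.
by apply/diff_locallyP; rewrite dE.
Qed.

Section CrTheory.
Context {R : realType}.

Lemma mulmxr_continuous p q (A : 'M[R]_(p, q)) :
  continuous (mulmxr A : 'rV[R]_p -> 'rV[R]_q).
Proof.
move=> x; have -> : (mulmxr A : 'rV[R]_p -> 'rV[R]_q) =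
    \sum_i (fun x : 'rV[R]_p => x 0 i *: row i A).
  by apply/funext => y; rewrite /= mulmx_sum_row fct_sumE.
apply: differentiable_continuous; apply: differentiable_sum => i.
by apply: differentiableZl; apply: differentiable_coord.
Qed.

Lemma differentiable_mulmxr {p q s : nat} (F : 'rV[R]_p -> 'rV[R]_q)
    (A : 'M[R]_(q, s)) x :
  differentiable F x -> differentiable (fun y => F y *m A) x.
Proof.
move=> dF; apply: (@differentiable_comp _ _ _ _ F (mulmxr A)) => //.
exact/linear_differentiable/mulmxr_continuous.
Qed.

Lemma derive_mulmxr {p q s : nat} (F : 'rV[R]_p -> 'rV[R]_q)
    (A : 'M[R]_(q, s)) x v :
  differentiable F x -> 'D_v (fun y => F y *m A) x = 'D_v F x *m A.
Proof.
move=> dF; rewrite deriveE; last exact: differentiable_mulmxr.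
rewrite (@diff_comp _ _ _ _ F (mulmxr A)) //.
  by rewrite diff_lin ?deriveE//; exact: mulmxr_continuous.
exact/linear_differentiable/mulmxr_continuous.
Qed.

(** Openness of [U] is what makes the directional derivatives on [U] depend only
    on the restriction of the function to [U]. *)
Lemma eq_Cr {r p q : nat} (U : set 'rV[R]_p) (F G : 'rV[R]_p -> 'rV[R]_q) :
  open U -> {in U, F =1 G} -> Cr r U F -> Cr r U G.
Proof.
move=> U_open.
have nearFG F1 G1 x : {in U, F1 =1 G1} -> U x ->
    \near x, F1 x = G1 x :> 'rV[R]_q.
  move=> FG Ux; near=> y; apply: FG; rewrite inE.
  by near: y; exact: open_nbhs_nbhs.
elim: r F G => [|r IH] F G FG /=.
  move=> F_cont x Ux; have := F_cont x Ux; rewrite /prop_for /continuous_at.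
  rewrite -FG ?inE//; apply: cvg_trans.
  by apply: (@near_eq_cvg _ _ (nbhs x)); exact: nearFG.
move=> [dF CF]; split=> [x Ux|v].
  by apply: near_eq_differentiable (dF x Ux); exact: nearFG.
apply: (IH _ _ _ (CF v)) => x; rewrite inE => Ux.
exact/near_eq_derive/nearFG.
Unshelve. all: by end_near. Qed.

Lemma subset_Cr {r p q : nat} (U V : set 'rV[R]_p) (F : 'rV[R]_p -> 'rV[R]_q) :
  V `<=` U -> Cr r U F -> Cr r V F.
Proof.
move=> VU; elim: r F => [|r IH] F /=; first by move=> F_cont x /VU/F_cont.
by case=> dF CF; split=> [x /VU/dF //|v]; apply: IH.
Qed.

Lemma CrW {r p q : nat} (U : set 'rV[R]_p) (F : 'rV[R]_p -> 'rV[R]_q) :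
  Cr r.+1 U F -> Cr r U F.
Proof.
elim: r F => [|r IH] F [dF CF] /=.
  by move=> x Ux; apply: differentiable_continuous; apply: dF.
by split=> // v; apply: IH.
Qed.

Lemma Cr_continuous {r p q : nat} (U : set 'rV[R]_p)
    (F : 'rV[R]_p -> 'rV[R]_q) :
  Cr r U F -> forall x, U x -> {for x, continuous F}.
Proof. by elim: r F => [//|r IH] F /CrW/IH. Qed.

Lemma Cr_cst {r p q : nat} (U : set 'rV[R]_p) (c : 'rV[R]_q) :
  Cr r U (fun=> c).
Proof.
elim: r c => [|r IH] c /=; first by move=> x _; exact: cst_continuous.
split=> [x _|v]; first exact: differentiable_cst.
by rewrite (_ : 'D_v _ = fun=> 0)//; apply/funext => x; rewrite derive_cst.
Qed.

Lemma Cr_mulmxr {r p q s : nat} (U : set 'rV[R]_p) (F : 'rV[R]_p -> 'rV[R]_q)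
    (A : 'M[R]_(q, s)) :
  open U -> Cr r U F -> Cr r U (fun x => F x *m A).
Proof.
move=> U_open; elim: r F => [|r IH] F /=.
  move=> F_cont x Ux.
  apply: (@continuous_comp _ _ _ F (mulmxr A)); first exact: F_cont.
  exact: mulmxr_continuous.
case=> dF CF; split=> [x Ux|v]; first exact/differentiable_mulmxr/dF.
apply: eq_Cr (IH _ (CF v)) => // x; rewrite inE => Ux.
by rewrite derive_mulmxr//; exact: dF.
Qed.

Lemma Cr_id {r p : nat} (U : set 'rV[R]_p) : Cr r U id.
Proof.
case: r => [|r] /=; first by move=> x _.
split=> [x _|v] //.
rewrite (_ : 'D_v _ = fun=> v); first exact: Cr_cst.
by apply/funext => x; rewrite derive_id.
Qed.

Lemma Cr_linear {r p q : nat} (U : set 'rV[R]_p)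
    (L : {linear 'rV[R]_p -> 'rV[R]_q}) : open U -> Cr r U L.
Proof.
move=> U_open; apply: eq_Cr (Cr_mulmxr _ id (lin1_mx L) U_open (Cr_id U)) => //.
by move=> x _; rewrite mul_rV_lin1.
Qed.

Lemma CrD {r p q : nat} (U : set 'rV[R]_p) (F G : 'rV[R]_p -> 'rV[R]_q) :
  open U -> Cr r U F -> Cr r U G -> Cr r U (fun x => F x + G x).
Proof.
move=> U_open; elim: r F G => [|r IH] F G /=.
  move=> F_cont G_cont x Ux.
  by apply: continuousD; [apply: F_cont|apply: G_cont].
move=> [dF CF] [dG CG]; split=> [x Ux|v].
  by apply: differentiableD; [exact: dF|exact: dG].
apply: eq_Cr (IH _ _ (CF v) (CG v)) => // x; rewrite inE => Ux.
by rewrite deriveD//; apply: diff_derivable; [exact: dF|exact: dG].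
Qed.

Lemma CrN {r p q : nat} (U : set 'rV[R]_p) (F : 'rV[R]_p -> 'rV[R]_q) :
  open U -> Cr r U F -> Cr r U (fun x => - F x).
Proof.
move=> U_open CF; apply: eq_Cr (Cr_mulmxr _ _ (- 1%:M) U_open CF) => //.
by move=> x _; rewrite mulmxN mulmx1.
Qed.

Lemma Cr_sum {r p q k : nat} (U : set 'rV[R]_p)
    (F : 'I_k -> 'rV[R]_p -> 'rV[R]_q) :
  open U -> (forall i, Cr r U (F i)) -> Cr r U (fun x => \sum_i F i x).
Proof.
move=> U_open CF.
have -> : (fun x => \sum_i F i x) = \sum_i F i.
  by apply/funext => x; rewrite fct_sumE.
elim/big_rec : _ => [|i G _ CG]; first exact: Cr_cst.
exact: CrD.
Qed.

(** The chain rule writes the derivative of a composite as a sum of such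
    products.  Having scalar factors only as coordinates of C^r maps makes the
    statement stable under the Leibniz rule, as induction on [r] requires. *)
Lemma Cr_coordM {r p q s t : nat} (U : set 'rV[R]_p) (F : 'rV[R]_p -> 'rV[R]_q)
    (G : 'rV[R]_p -> 'rV[R]_s) (i : 'I_q) (j : 'I_s) (w : 'rV[R]_t) :
  open U -> Cr r U F -> Cr r U G ->
  Cr r U (fun x => (F x 0 i * G x 0 j) *: w).
Proof.
move=> U_open; elim: r F G => [|r IH] F G.
  move=> /= F_cont G_cont x Ux.
  have cont_coord k (H : 'rV[R]_p -> 'rV[R]_k) l :
      {for x, continuous H} -> {for x, continuous (fun y => H y 0 l : R)}.
    move=> H_cont; apply: (@continuous_comp _ _ _ H (fun M => M 0 l)) => //.
    exact: coord_continuous.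
  apply: continuousZ; last exact: cst_continuous.
  apply: continuousM.
  - exact/cont_coord/F_cont.
  - exact/cont_coord/G_cont.
move=> CF CG; have := (CrW _ _ CF, CrW _ _ CG).
case: CF CG => dF CF [dG CG] [CF' CG'].
have dcoord k (H : 'rV[R]_p -> 'rV[R]_k) l x :
    differentiable H x -> differentiable (fun y => H y 0 l : R) x.
  move=> dH; apply: (@differentiable_comp _ _ _ _ H (fun M => M 0 l)) => //.
  exact: differentiable_coord.
have Dcoord k (H : 'rV[R]_p -> 'rV[R]_k) l x v :
    differentiable H x -> 'D_v (fun y => H y 0 l : R) x = 'D_v H x 0 l.
  by move=> dH; rewrite derive_mx ?mxE//; exact: diff_derivable.
split=> [x Ux|v].
  apply: differentiableZl; apply: differentiableM.
  - exact/dcoord/dF.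
  - exact/dcoord/dG.
apply: eq_Cr (CrD _ _ _ U_open (IH _ _ CF' (CG v)) (IH _ _ (CF v) CG')) => //.
move=> x; rewrite inE => Ux.
have dFi := dcoord _ _ i x (dF x Ux); have dGj := dcoord _ _ j x (dG x Ux).
rewrite [RHS]deriveE; last by apply: differentiableZl; apply: differentiableM.
rewrite diffZl; last exact: differentiableM.
rewrite -deriveE; last exact: differentiableM.
rewrite (@deriveM _ _ (fun y => F y 0 i) (fun y => G y 0 j));
  [|exact: diff_derivable..].
rewrite !Dcoord; [|exact: dF|exact: dG].
by rewrite -scalerDl ['D_v F x 0 i * _]mulrC.
Qed.

(** By the chain rule, D_v (G o F) x is the sum over i of
    (D_v F x)_i (D_(e_i) G)(F x).  If F and G are C^(r+1), then D_v F is C^r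
    and, by induction, so is each D_(e_i) G o F. *)
Lemma Cr_comp {r p q s : nat} (U : set 'rV[R]_p) (V : set 'rV[R]_q)
    (F : 'rV[R]_p -> 'rV[R]_q) (G : 'rV[R]_q -> 'rV[R]_s) :
  open U -> open V -> (forall x, U x -> V (F x)) ->
  Cr r U F -> Cr r V G -> Cr r U (fun x => G (F x)).
Proof.
move=> U_open V_open FUV; elim: r s G => [|r IH] s G.
  move=> /= F_cont G_cont x Ux.
  by apply: continuous_comp; [exact: F_cont|apply/G_cont/FUV].
move=> CF; have CF' := CrW _ _ CF; case: CF => dF CF [dG CG].
split=> [x Ux|v].
  by apply: (@differentiable_comp _ _ _ _ F G); [exact: dF|apply/dG/FUV].
have key : Cr r U (fun x => \sum_(i < q) \sum_(j < s)
    ('D_v F x 0 i * 'D_('e_i) G (F x) 0 j) *: 'e_j).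
  apply: Cr_sum => // i; apply: Cr_sum => // j.
  apply: (Cr_coordM U (fun x => 'D_v F x) (fun x => 'D_('e_i) G (F x))) => //.
  - exact: CF.
  - exact: (IH s _ CF' (CG 'e_i)).
apply: eq_Cr key => // x; rewrite inE => Ux.
have [dFx dGFx] : differentiable F x /\ differentiable G (F x).
  by split; [exact: dF|apply/dG/FUV].
rewrite [RHS]deriveE; last exact: (@differentiable_comp _ _ _ _ F G).
rewrite (@diff_comp _ _ _ _ F G)//= -(deriveE v dFx).
rewrite [in RHS](row_sum_delta ('D_v F x)) linear_sum.
apply: eq_bigr => i _; rewrite linearZ -deriveE//.
rewrite [in RHS](row_sum_delta ('D_('e_i) G (F x))) [RHS]scaler_sumr.
by apply: eq_bigr => j _; rewrite scalerA.
Qed.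

Lemma open_preimage_Cr {r p q : nat} (U : set 'rV[R]_p) (V : set 'rV[R]_q)
    (F : 'rV[R]_p -> 'rV[R]_q) :
  open U -> open V -> Cr r U F -> open (U `&` F @^-1` V).
Proof.
move=> U_open V_open CF; rewrite openE => x [Ux VFx].
apply: filterI; first exact: open_nbhs_nbhs.
by apply: (Cr_continuous _ _ CF x Ux); exact: open_nbhs_nbhs.
Qed.

Lemma open_preimage_mulmxr {p q : nat} (V : set 'rV[R]_q) (A : 'M[R]_(p, q)) :
  open V -> open [set x : 'rV[R]_p | V (x *m A)].
Proof.
by move=> V_open; have /continuousP := @mulmxr_continuous p q A; apply.
Qed.
End CrTheory.

(** * Images of right inverses of linear maps *)

Section LinearSection.
Variables (R : realType) (r d M : nat).
Variables (D : set 'rV[R]_d) (F : 'rV[R]_d -> 'rV[R]_M) (A : 'M[R]_(M, d)).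
Hypotheses (D_open : open D) (F_Cr : Cr r D F).
Hypotheses (A_full : row_full A) (FK : forall q, D q -> F q *m A = q).

(** As [A] has rank [d], right multiplication by [A] is that by [T], followed by
   the projection onto the first [d] coordinates and an automorphism of R^d; so
   [T] maps the kernel of [A] onto 0 x R^(M-d). *)
Let T := col_ebase A.
Let phi (w : 'rV[R]_M) := (w - F (w *m A)) *m T + Defs.incl M (w *m A).
Let psi (z : 'rV[R]_M) :=
  (z - Defs.incl M (Defs.proj d z)) *m invmx T + F (Defs.proj d z).
Let U := [set w : 'rV[R]_M | D (w *m A)].
Let V := [set z : 'rV[R]_M | D (Defs.proj d z)].

Let rankA : \rank A = d. Proof. exact/eqP. Qed.
Let dM : (d <= M)%N. Proof. by rewrite -rankA rank_leq_row. Qed.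

Let inclK : cancel (@Defs.incl R d M) (@Defs.proj R d M).
Proof.
by move=> y; rewrite /Defs.incl /Defs.proj -mulmxA pid_mx_id// pid_mx_1 mulmx1.
Qed.

Let projB (z w : 'rV[R]_M) :
  Defs.proj d (z - w) = Defs.proj d z - Defs.proj d w.
Proof. by rewrite /Defs.proj mulmxBl. Qed.

Let AE : A = T *m pid_mx d *m row_ebase A.
Proof. by rewrite -[LHS]mulmx_ebase rankA. Qed.

Let mulT (w : 'rV[R]_M) : w *m A = 0 -> Defs.proj d (w *m T) = 0.
Proof.
rewrite AE !mulmxA /Defs.proj => /(congr1 (mulmx^~ (invmx (row_ebase A)))).
by rewrite mulmxK ?row_ebase_unit// mul0mx.
Qed.

Let mulTA (z : 'rV[R]_M) : Defs.proj d z = 0 -> z *m invmx T *m A = 0.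
Proof.
rewrite AE /Defs.proj !mulmxA mulmxKV ?col_ebase_unit// => ->.
by rewrite mul0mx.
Qed.

Let proj_phi w : U w -> Defs.proj d (phi w) = w *m A.
Proof.
move=> Uw; rewrite /phi /Defs.proj mulmxDl -!/(Defs.proj _ _) inclK.
rewrite mulT ?add0r//.
by rewrite mulmxBl FK// subrr.
Qed.

Let psiA z : V z -> psi z *m A = Defs.proj d z.
Proof.
move=> Vz; rewrite /psi mulmxDl FK// mulTA ?add0r//.
by rewrite projB inclK subrr.
Qed.

Let inverse_phi_psi : inverse_on U V phi psi.
Proof.
split=> [w Uw|z Vz]; split.
- by rewrite /V /= proj_phi.
- by rewrite /psi proj_phi// /phi addrK mulmxK ?col_ebase_unit// subrK.
- by rewrite /U /= psiA.
- by rewrite /phi psiA// /psi addrK mulmxKV ?col_ebase_unit// subrK.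
Qed.

Let openU : open U.
Proof. exact: open_preimage_mulmxr. Qed.

Let openV : open V.
Proof. exact: open_preimage_mulmxr. Qed.

(** The chart is global.  It maps [F q] to [(q, 0)], because [w - F (w *m A)]
    vanishes at [w = F q]; conversely it vanishes at the preimage of any point
    of the slice. *)
Lemma linear_section_chart : slice_chart r d (F @` D) U V phi psi.
Proof.
split=> //.
  split=> //.
  - apply: CrD => //; apply: Cr_mulmxr => //; last first.
      by apply: Cr_mulmxr => //; exact: Cr_id.
    apply: CrD => //; first exact: Cr_id.
    apply: CrN => //; apply: (Cr_comp U D (mulmxr A) F) => //.
    by apply: Cr_mulmxr => //; exact: Cr_id.
  - have Cproj : Cr r V (@Defs.proj R d M).
      by apply: Cr_mulmxr => //; exact: Cr_id.
    apply: CrD => //; last exact: (Cr_comp V D (@Defs.proj R d M) F).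
    apply: Cr_mulmxr => //; apply: CrD => //; first exact: Cr_id.
    by apply: CrN => //; exact: Cr_mulmxr.
apply/seteqP; split=> [_ [w [[q Dq <-] _] <-]|z [Vz z0]].
  have -> : phi (F q) = Defs.incl M q by rewrite /phi FK// subrr mul0mx add0r.
  split; first by rewrite /V /= inclK.
  move=> i di; rewrite /Defs.incl mxE big1// => j _.
  rewrite mxE; case: eqP => [ji|_] /=; last by rewrite mulr0.
  by rewrite -ji leqNgt ltn_ord in di.
have zE : Defs.incl M (Defs.proj d z) = z.
  apply/rowP => i; rewrite /Defs.incl /Defs.proj -mulmxA pid_mx_id//.
  have [di|id] := leqP d i.
    rewrite z0// mxE big1// => j _; rewrite mxE.
    case: eqP => [ji|_] /=; last by rewrite mulr0.
    by rewrite ji ltnNge di mulr0.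
  rewrite mxE (bigD1 i)//= mxE eqxx id mulr1 big1 ?addr0// => j ji.
  by rewrite mxE -[_ == _ :> nat]/(j == i) (negbTE ji) mulr0.
have psiE : psi z = F (Defs.proj d z) by rewrite /psi zE subrr mul0mx add0r.
have [_ /(_ z Vz)[Upsi phiK]] := inverse_phi_psi.
exists (psi z) => //; split=> //; by rewrite psiE; exists (Defs.proj d z).
Qed.

(** In any slice chart of the image, [F] and its inverse are composites of C^r
    maps between open subsets of vector spaces, because the inverse is the
    restriction of a map defined, and linear, on all of R^M. *)
Lemma linear_section_diffeo : Cr_diffeo_onto r d D (F @` D) F.
Proof.
split=> //.
- move=> _ [q Dq <-]; exists U, V, phi, psi.
  by split; [rewrite /U /= FK|exact: linear_section_chart].
- split=> [q Dq|q Dq|U' V' phi' psi' [_ [U'_open V'_open _ phi'_Cr _] _]].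
  + by exists q.
  + exact: (Cr_continuous _ _ F_Cr).
  + have DU_open := open_preimage_Cr D U' F D_open U'_open F_Cr.
    apply: Cr_mulmxr => //.
    apply: (Cr_comp _ U' F phi') => //; first by move=> x [].
    by apply: (subset_Cr D _ F _ F_Cr) => x [].
- exists (mulmxr A); split.
    split=> [q Dq|_ [q Dq <-]]; last by rewrite /= FK.
    by split; [exists q|exact: FK].
  move=> U' V' phi' psi' [_ [U'_open V'_open _ _ psi'_Cr] _].
  have W_open : open [set y : 'rV[R]_d | V' (Defs.incl M y)].
    exact: (open_preimage_mulmxr V' (pid_mx d)).
  apply: Cr_mulmxr => //; apply: (Cr_comp _ V' (@Defs.incl R d M) psi') => //.
  by apply: Cr_mulmxr => //; exact: Cr_id.
Qed.
End LinearSection.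

(** * Stacking *)

Section Stack.
Context {R : realType} {r p : nat} (U : set 'rV[R]_p).
Hypothesis U_open : open U.

Lemma Cr_row_mx {q s : nat} (F : 'rV[R]_p -> 'rV[R]_q)
    (G : 'rV[R]_p -> 'rV[R]_s) :
  Cr r U F -> Cr r U G -> Cr r U (fun x => row_mx (F x) (G x)).
Proof.
move=> CF CG; have := CrD _ _ _ U_open
  (Cr_mulmxr _ _ (row_mx 1%:M 0) U_open CF)
  (Cr_mulmxr _ _ (row_mx 0 1%:M) U_open CG).
apply: eq_Cr => // x _.
by rewrite !mul_mx_row !mulmx1 !mulmx0 add_row_mx addr0 add0r.
Qed.

Lemma Cr_mxvec {k q : nat} (F : 'I_k -> 'rV[R]_p -> 'rV[R]_q) :
  (forall i, Cr r U (F i)) -> Cr r U (fun x => mxvec (\matrix_(i < k) F i x)).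
Proof.
move=> CF; pose L i := lin1_mx (mxvec \o @mulmx R k 1 q (delta_mx i 0)).
have := Cr_sum U (fun i x => F i x *m L i) U_open
  (fun i => Cr_mulmxr _ _ (L i) U_open (CF i)).
apply: eq_Cr => // x _.
under eq_bigr do rewrite mul_rV_lin1 /=.
rewrite -linear_sum; congr mxvec; apply/matrixP => i j.
rewrite summxE (bigD1 i)//= big1 => [|l li]; rewrite !mxE big_ord1 !mxE.
  by rewrite !eqxx mul1r addr0.
by rewrite eq_sym (negbTE li) mul0r.
Qed.
End Stack.

(** * The rollout *)

Section Rollout.
Context {R : realType} {n m N r : nat}.
Variables (O : set 'rV[R]_(n + m)) (f : 'rV[R]_(n + m) -> 'rV[R]_n).
Hypotheses (O_open : open O) (f_Cr : Cr r O f).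

Lemma input_row_mx (u : nat -> 'rV[R]_m) (x : 'rV[R]_n) k :
  (k < N)%N -> input (row_mx x (mxvec (\matrix_(i < N) u i))) k = u k.
Proof.
move=> kN; rewrite /input insubT row_mxKr mxvecK.
by apply/rowP => j; rewrite !mxE.
Qed.

Lemma Cr_input {U : set 'rV[R]_(n + N * m)} k :
  open U -> Cr r U (fun q => input q k).
Proof.
move=> U_open; rewrite /input; case: insubP => [i _ _|_]; last exact: Cr_cst.
have -> : (fun q : 'rV[R]_(n + N * m) => row i (vec_mx (rsubmx q))) =
    (row i \o vec_mx \o rsubmx).
  by [].
exact: Cr_linear.
Qed.

(** Openness and smoothness have to be proved together: the next domain is the
    preimage of [O] under the current state and input, which is open because
    this map is continuous on a domain already known to be open. *)
Lemma state_Cr k :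
  let D := [set q : 'rV[R]_(n + N * m) |
    forall j, (j < k)%N -> O (row_mx (state f q j) (input q j))] in
  open D /\ Cr r D (fun q => state f q k).
Proof.
elim: k => [|k [D_open CS]] D.
  have -> : D = setT by apply/seteqP; split.
  split; first exact: openT.
  exact: (Cr_linear setT (@lsubmx R 1 n (N * m)) openT).
set D' := (X in open X) in D_open.
have Cpair : Cr r D' (fun q => row_mx (state f q k) (input q k)).
  by apply: Cr_row_mx => //; exact: Cr_input.
have DE : D = D' `&` (fun q => row_mx (state f q k) (input q k)) @^-1` O.
  apply/seteqP; split=> [q Dq|q [D'q Oq] j].
    by split=> [j jk|]; apply: Dq; rewrite // ltnS ltnW.
  by rewrite ltnS leq_eqVlt => /predU1P[->|/D'q].
have D_open' : open D.
  by rewrite DE; exact: (open_preimage_Cr _ _ _ D_open O_open Cpair).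
split; first exact: D_open'.
apply: (Cr_comp _ O (fun q => row_mx (state f q k) (input q k)) f) => //.
- by move=> q; apply.
- by apply: (subset_Cr D' _ _ _ Cpair); rewrite DE => q [].
Qed.

Lemma rollout_domain_open : open (rollout_domain O f N).
Proof. exact: (state_Cr N).1. Qed.

Lemma rollout_Cr : Cr r (rollout_domain O f N) (rollout f N).
Proof.
have D_open := rollout_domain_open.
apply: Cr_row_mx => //; apply: Cr_mxvec => // k; first exact: Cr_input.
apply: (subset_Cr _ _ _ _ (state_Cr k).2) => q Dq j jk; apply: Dq.
by rewrite (leq_trans jk)// -ltnS.
Qed.

(** A trajectory is the rollout of its own initial state and inputs. *)
Lemma behaviorE : behavior O f N = rollout f N @` rollout_domain O f N.
Proof.
apply/seteqP; split=> [_ [u [x [-> xu]]]|_ [q Dq <-]]; last first.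
  by exists (input q), (state f q); split=> // k /Dq.
pose q : 'rV[R]_(n + N * m) := row_mx (x 0%N) (mxvec (\matrix_(i < N) u i)).
have inputE k : (k < N)%N -> input q k = u k by exact: input_row_mx.
have stateE k : (k <= N)%N -> state f q k = x k.
  elim: k => [|k IH] kN /=; first by rewrite row_mxKl.
  by rewrite IH 1?ltnW// inputE// -(xu k kN).2.
exists q => [k kN|].
  by rewrite stateE 1?ltnW// inputE//; exact: (xu k kN).1.
congr (row_mx (mxvec _) (mxvec _)); apply/row_matrixP => k; rewrite !rowK.
  by rewrite inputE.
by rewrite stateE// -ltnS.
Qed.

Definition free_coord (w : 'rV[R]_(N * m + N.+1 * n)) : 'rV[R]_(n + N * m) :=
  row_mx (row ord0 (vec_mx (rsubmx w) : 'M[R]_(N.+1, n))) (lsubmx w).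

Lemma free_coord_is_linear : linear free_coord.
Proof.
by move=> a v w; rewrite /free_coord !linearP /= scale_row_mx add_row_mx.
Qed.
HB.instance Definition _ := GRing.isLinear.Build R _ _ _ free_coord
  free_coord_is_linear.

(** This makes the rollout injective, with an inverse that extends linearly to
    the whole space. *)
Lemma free_coord_rollout q : free_coord (rollout f N q) = q.
Proof.
rewrite /free_coord row_mxKr mxvecK rowK row_mxKl /= -[RHS]hsubmxK.
congr row_mx; apply/eqP; rewrite -(can_eq vec_mxK) mxvecK; apply/eqP.
by apply/row_matrixP => k; rewrite rowK /input valK.
Qed.

Lemma free_coord_surjective q : exists w, free_coord w = q.
Proof.
(* Only the initial state is selected: the later ones are arbitrary. *)
exists (row_mx (rsubmx q) (mxvec (\matrix_(k < N.+1) lsubmx q))).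
by rewrite /free_coord row_mxKr mxvecK rowK row_mxKl hsubmxK.
Qed.

Lemma free_coord_full : row_full (lin1_mx free_coord).
Proof.
rewrite -sub1mx; apply/row_subP => i.
have [w <-] := free_coord_surjective (row i 1%:M).
by rewrite -mul_rV_lin1 submxMl.
Qed.
End Rollout.

Theorem theorem3p3 (R : realType) (n m N r : nat)
    (hn : (0 < n)%N) (hm : (0 < m)%N) (hN : (0 < N)%N) (hr : (1 <= r)%N)
    (O : set 'rV[R]_(n + m)) (f : 'rV[R]_(n + m) -> 'rV[R]_n)
    (O_open : open O) (f_Cr : Cr r O f) :
  embedded_submanifold r (n + N * m) (behavior O f N) /\
  Cr_diffeo_onto r (n + N * m) (rollout_domain O f N) (behavior O f N)
    (rollout f N).
Proof.
rewrite behaviorE.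
suff diffeo : Cr_diffeo_onto r (n + N * m) (rollout_domain O f N)
    (rollout f N @` rollout_domain O f N) (rollout f N).
  by split=> //; case: diffeo.
apply: (@linear_section_diffeo _ _ _ _ _ _ (lin1_mx (@free_coord R n m N))).
- exact: (rollout_domain_open _ _ O_open f_Cr).
- exact: rollout_Cr.
- exact: free_coord_full.
- by move=> q _; rewrite mul_rV_lin1; exact: free_coord_rollout.
Qed.
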